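(* Suppose $D$ is a (strongly) 2-connected, noneven digraph with $n$ vertices such that $\mathrm{d}(v) \geq n$ for all its vertices $v$. Then either $D = W_4$ or $D = C_4^*$ (up to isomorphism).
   Context: Digraphs are finite, without loops and without parallel arcs (both arcs $(u,v)$ and $(v,u)$ may be present). The degree $\mathrm{d}(v)$ of a vertex $v$ is the sum of its indegree and its outdegree. A digraph is strong if for every ordered pair of vertices $(u,v)$ there is a directed path from $u$ to $v$. A digraph is strongly 2-connected (2-connected for short) if it has at least 3 vertices and the removal of at most one vertex always leaves a strong digraph. A digraph $D$ is noneven if one can assign a weight in $\{0,1\}$ to each arc so that no directed (simple) cycle of $D$, including cycles of length 2, has even total weight. $W_4$ is the digraph on vertices $1,2,3,4$ with the eight arcs $(1,2),(2,3),(3,4),(4,1),(1,3),(3,1),(2,4),(4,2)$; up to isomorphism it is the only semi-complete digraph (at least one arc between any two distinct vertices) on four vertices in which every vertex has indegree and outdegree two. $C_4^*$ is the digraph obtained from the undirected 4-cycle by replacing each edge $uv$ by the two arcs $(u,v)$ and $(v,u)$. *)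

(* Defs.v *)
From mathcomp Require Import all_boot.
Set Implicit Arguments.
Unset Strict Implicit.
Unset Printing Implicit Defensive.

(* The arc set is a relation, so parallel arcs cannot occur. *)
Record digraph := Digraph {
  vertex :> finType;
  arc : rel vertex;
  arc_irrefl : irreflexive arc
}.

Definition indegree (D : digraph) (v : D) : nat := #|[set u : D | arc u v]|.
Definition outdegree (D : digraph) (v : D) : nat := #|[set u : D | arc v u]|.
Definition degree (D : digraph) (v : D) : nat := indegree v + outdegree v.

Definition strong (D : digraph) : Prop :=
  forall u v : D, connect (@arc D) u v.

Definition induced_arc (D : digraph) (A : {set D}) : rel {x : D | x \in A} :=
  fun u v => arc (val u) (val v).

Lemma induced_arc_irrefl (D : digraph) (A : {set D}) :
  irreflexive (@induced_arc D A).
Proof. by move=> u; apply: arc_irrefl. Qed.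

Definition induced (D : digraph) (A : {set D}) : digraph :=
  Digraph (@induced_arc_irrefl D A).

Definition strongly_2connected (D : digraph) : Prop :=
  3 <= #|D| /\ forall S : {set D}, #|S| <= 1 -> strong (induced (~: S)).

(* A directed cycle is its sequence of distinct vertices: the arcs are the
   pairs (x, next c x), including the closing one. *)
Definition dicycle (D : digraph) (c : seq D) : Prop :=
  c <> [::] /\ ucycle (@arc D) c.

Definition cycle_weight (D : digraph) (w : D -> D -> bool) (c : seq D) : nat :=
  \sum_(x <- c) w x (next c x).

(* Values of w on pairs that are not arcs are never used. *)
Definition noneven (D : digraph) : Prop :=
  exists w : D -> D -> bool,
    forall c : seq D, dicycle c -> odd (cycle_weight w c).

Definition isomorphic (D E : digraph) : Prop :=
  exists f : D -> E,
    bijective f /\ forall u v : D, arc (f u) (f v) = arc u v.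

(* Vertices are numbered from 0 rather than from 1. *)
Definition W4_arc : rel 'I_4 := fun i j =>
  (val i, val j) \in
    [:: (0, 1); (1, 2); (2, 3); (3, 0); (0, 2); (2, 0); (1, 3); (3, 1)].

Lemma W4_arc_irrefl : irreflexive W4_arc.
Proof. by case=> [[|[|[|[|i]]]] lti]. Qed.

Definition W4 : digraph := Digraph W4_arc_irrefl.

Definition C4star_arc : rel 'I_4 := fun i j =>
  (j == i.+1 %[mod 4]) || (i == j.+1 %[mod 4]).

Lemma C4star_arc_irrefl : irreflexive C4star_arc.
Proof. by case=> [[|[|[|[|i]]]] lti]. Qed.

Definition C4star : digraph := Digraph C4star_arc_irrefl.

(* Main.v *)
From mathcomp Require Import all_boot.
Require Import Defs.

Set Implicit Arguments.
Unset Strict Implicit.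
Unset Printing Implicit Defensive.

(** Call the pair {u, v} a digon when both arcs between u and v are present.
    Everything rests on parity: if every cycle has odd weight, then an odd
    number of cycles, digons included, cannot together use each arc an even
    number of times.  With a path that avoids a prescribed vertex, which strong
    2-connectivity provides, this gives the following.

    - The two ends of a digon have no common out-neighbour
      ([digon_in_nbrs]) and no common in-neighbour ([digon_out_nbrs]).
    - Two digon-neighbours of the same vertex are nonadjacent
      ([digon_nbrs_no_arc]).

    Let Z(v) be the set of digon-neighbours and N(v) the set of
    non-neighbours of v.  Counting the arcs at v, the bound d(v) >= n says
    exactly that |N(v)| < |Z(v)|.  If u and v form a digon, then
    Z(u) \ {v} is contained in N(v), so |Z(u)| <= |N(v)| + 1 <= |Z(v)|; by
    symmetry these are equalities and Z(u) = {v} + N(v) ([digon_nbrsE]).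
    So the digons form disjoint complete bipartite graphs with independent
    sides, and vertices of different components are joined by exactly one
    arc.

    If some vertex a has two digon-neighbours, its component contains a copy
    of C_4^*.  A fifth vertex of that component would give a bidirected
    K_{2,3}, which is even ([no_K23]).  A vertex outside the component is
    joined to the four in alternating directions by the first property, and
    this is even too ([no_C4star_pyramid]).  So n = 4.

    Otherwise the digons form a perfect matching, and the first property
    forces the arcs between two digons {v, v'} and {x, x'} to be a 4-cycle
    v x v' x' in one of its two orientations ([digon_pair_arcs]), that is, a
    copy of W_4.  Three digons then form the digraph on Z/6 in which each
    vertex dominates the next three, and that digraph is even
    ([no_circular6]).  So again n = 4. *)

(** * Odd cycles as closed walks *)

Section Parity.
Context (D : digraph).
Implicit Types (w : D -> D -> bool) (x y : D) (p s : seq D).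

Fixpoint walk_parity w x p : bool :=
  if p is y :: q then w x y (+) walk_parity w y q else false.

Definition odd_on_cycles w :=
  forall x p, uniq (x :: p) -> path (@arc D) x (rcons p x) ->
  walk_parity w x (rcons p x).

Lemma walk_parity_cat w x p q :
  walk_parity w x (p ++ q) = walk_parity w x p (+) walk_parity w (last x p) q.
Proof. by elim: p x => //= y p IH x; rewrite IH addbA. Qed.

(** Inside the cycle starting at [y0], [next] is computed by [next_at], whose
    current position [y] moves along the list; this generality is what makes
    the induction go through. *)
Lemma odd_weight_next_at w y0 y p : uniq (y :: p) ->
  odd (\sum_(x <- y :: p) w x (next_at x y0 y p)) =
    walk_parity w y (rcons p y0).
Proof.
elim: p y => [|y' p IH] y /=.
  by rewrite big_seq1 eqxx oddb addbF.
move=> /andP[yNp Up]; rewrite big_cons /= eqxx oddD oddb; congr (_ (+) _).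
rewrite -IH //; congr odd; apply: eq_big_seq => x xp.
by rewrite /= ifN //; apply: contraNneq yNp => <-.
Qed.

Lemma noneven_odd_on_cycles : noneven D -> exists w, odd_on_cycles w.
Proof.
case=> w odd_w; exists w => x p Up xpx.
rewrite -odd_weight_next_at //; apply: (odd_w (x :: p)).
by split; rewrite // /ucycle /= xpx.
Qed.

(** Small configurations are refuted by exhibiting several cycles on the same
    few vertices.  Naming these cycles by lists of positions in one
    duplicate-free list makes their simplicity a matter of computation. *)
Lemma odd_on_nth_cycle w x0 s i l : odd_on_cycles w -> uniq s ->
    uniq (i :: l) -> all (gtn (size s)) (i :: l) ->
    path (@arc D) (nth x0 s i) (rcons (map (nth x0 s) l) (nth x0 s i)) ->
  walk_parity w (nth x0 s i) (rcons (map (nth x0 s) l) (nth x0 s i)).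
Proof.
move=> odd_w Us Uil /allP lt_il; apply: odd_w.
rewrite -map_cons map_inj_in_uniq // => j k /lt_il ltj /lt_il ltk /eqP.
by rewrite nth_uniq // => /eqP.
Qed.

(** Because the path is simple and misses [x], both it and its extension by
    [x] close up into cycles as soon as the needed arcs are present. *)
Lemma path_avoiding x u v : strongly_2connected D -> u != x -> v != x ->
  exists p, [/\ path (@arc D) u p, last u p = v, uniq (u :: p) & x \notin u :: p].
Proof.
move=> [_ /(_ [set x])]; rewrite cards1 => /(_ isT) H ux vx.
rewrite -!in_setC1 in ux vx; rewrite -[u]/(val (Sub u ux : {y | y \in ~: [set x]})).
rewrite -[v]/(val (Sub v vx : {y | y \in ~: [set x]})).
move: (Sub u ux) (Sub v vx) => u' v'.
have /connectP[_ /shortenP[p pP Up _] ->] := H u' v'.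
exists (map val p); split; rewrite ?path_map ?last_map -?map_cons ?map_inj_uniq //.
  exact: val_inj.
by apply/mapP => -[[y yx] _ /= xy]; have := yx : y \in [set~ x]; rewrite -xy setC11.
Qed.

(** * Digons, non-neighbours and the degree bound *)

Definition digon u v := @arc D u v && arc v u.
Definition digon_nbrs v := [set u | digon v u].
Definition non_nbrs v := [set u : D | [&& u != v, ~~ arc u v & ~~ arc v u]].

Lemma digonC u v : digon u v = digon v u.
Proof. by rewrite /digon andbC. Qed.

Lemma arc_neq u v : @arc D u v -> u != v.
Proof. by apply: contraTneq => ->; rewrite arc_irrefl. Qed.

Lemma digon_neq u v : digon u v -> u != v.
Proof. by case/andP => /arc_neq. Qed.

(** The in- and out-neighbourhoods of [v] intersect in its digon-neighbours
    and their union misses exactly [v] and its non-neighbours, so that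
    d(v) = (n - 1 - |N(v)|) + |Z(v)|. *)
Lemma ltn_non_nbrs_digon_nbrs v : #|D| <= degree v ->
  #|non_nbrs v| < #|digon_nbrs v|.
Proof.
rewrite /degree /indegree /outdegree -cardsUI.
set A := _ :|: _; set B := _ :&: _; have -> : B = digon_nbrs v.
  by apply/setP => u; rewrite !inE andbC.
have AN : [disjoint A & v |: non_nbrs v].
  apply/pred0P => u /=; rewrite !inE; apply/negP => /andP[].
  by case: eqP => [->|_]; rewrite ?arc_irrefl //=; case: arc; case: arc.
have := max_card (A :|: (v |: non_nbrs v)).
rewrite cardsU (disjoint_setI0 AN) cards0 subn0 cardsU1 !inE eqxx /= addnA addn1.
by move=> le_AN le_D; have := leq_trans le_AN le_D; rewrite addSnnS leq_add2l.
Qed.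

Lemma isomorphic_of_enum n (E : rel 'I_n) (E_irr : irreflexive E) x0 s :
    size s = n -> uniq s -> (forall x, x \in s) ->
    (forall i j : 'I_n, arc (nth x0 s i) (nth x0 s j) = E i j) ->
  isomorphic D (Digraph E_irr).
Proof.
move=> sz_s Us s_all arcE.
have lt_index x : index x s < n by rewrite -sz_s index_mem.
exists (fun x => Ordinal (lt_index x)); split.
  exists (fun i : 'I_n => nth x0 s i) => [x | i]; first exact: nth_index.
  by apply: val_inj; rewrite /= index_uniq ?sz_s.
by move=> u v; rewrite /= -arcE /= !nth_index.
Qed.

(** * Digons in a strongly 2-connected noneven digraph *)

Section Noneven.
Context (w : D -> D -> bool).
Hypothesis odd_w : odd_on_cycles w.
Hypothesis conn : strongly_2connected D.

Lemma odd_digon u v : digon u v -> w u v = ~~ w v u.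
Proof.
move=> uv; have [auv avu] := andP uv.
have := odd_w (x := u) (p := [:: v]); rewrite /= inE digon_neq // auv avu.
by move=> /(_ isT isT); case: (w u v); case: (w v u).
Qed.

(** Close up a path from [v] to [x] avoiding [x'] in two ways: directly, and
    through [x'].  Both cycles are odd and share the path. *)
Lemma weight_through_in_digon x x' v : digon x x' -> arc x v -> arc x' v ->
  w x v = w x x' (+) w x' v.
Proof.
move=> xx' xv x'v; have [axx' _] := andP xx'.
have vx' : v != x' by rewrite eq_sym arc_neq.
have vx : v != x by rewrite eq_sym arc_neq.
have [p [pP p_last Up x'p]] := path_avoiding conn vx' (digon_neq xx').
have := odd_w (x := v) (p := p) Up.
have := odd_w (x := v) (p := rcons p x').
rewrite -rcons_cons rcons_uniq Up x'p !rcons_path !last_rcons p_last pP /=.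
rewrite axx' xv x'v -!cats1 -catA !walk_parity_cat /= p_last !addbF.
move=> /(_ isT isT) + /(_ isT).
by case: (walk_parity w v p); case: (w x v); case: (w x x'); case: (w x' v).
Qed.

(** Exchanging [x] and [x'] in the previous lemma and adding the two
    equations gives w x x' = w x' x, so the 2-cycle would be even. *)
Lemma digon_in_nbrs x x' v : digon x x' -> ~~ (arc x v && arc x' v).
Proof.
move=> xx'; apply/andP => -[xv x'v].
have := weight_through_in_digon xx' xv x'v.
rewrite digonC in xx'; have := weight_through_in_digon xx' x'v xv.
rewrite (odd_digon xx').
by case: (w x x'); case: (w x v); case: (w x' v).
Qed.

(** The mirror image: a path from [x] to [v] avoiding [x'] is entered from [v]
    directly or through [x']. *)
Lemma weight_through_out_digon x x' v : digon x x' -> arc v x -> arc v x' ->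
  w v x = w v x' (+) w x' x.
Proof.
move=> xx' vx vx'; have [_ ax'x] := andP xx'.
have [p [pP p_last Up x'p]] :=
  path_avoiding conn (digon_neq xx') (arc_neq vx').
have := odd_w (x := x) (p := p) Up.
have := odd_w (x := x') (p := x :: p).
rewrite cons_uniq x'p Up /= !rcons_path p_last pP ax'x vx vx' -!cats1.
rewrite !walk_parity_cat /= p_last !addbF => /(_ isT isT) + /(_ isT).
by case: (walk_parity w x p); case: (w v x); case: (w v x'); case: (w x' x).
Qed.

Lemma digon_out_nbrs x x' v : digon x x' -> ~~ (arc v x && arc v x').
Proof.
move=> xx'; apply/andP => -[vx vx'].
have := weight_through_out_digon xx' vx vx'.
rewrite digonC in xx'; have := weight_through_out_digon xx' vx' vx.
rewrite (odd_digon xx').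
by case: (w x x'); case: (w v x); case: (w v x').
Qed.

(** Take a path from [y] to [x] avoiding [v].  Of the five odd cycles
    v x y, v y ... x, x y ... x and the 2-cycles on {v, x} and {v, y}, each
    arc lies on exactly two. *)
Lemma digon_nbrs_no_arc v x y : digon v x -> digon v y -> ~~ arc x y.
Proof.
move=> vx vy; apply/negP => xy.
have [avx axv] := andP vx; have [avy ayv] := andP vy.
have yv : y != v by rewrite eq_sym digon_neq.
have xv : x != v by rewrite eq_sym digon_neq.
have [p [pP p_last Up vp]] := path_avoiding conn yv xv.
have := odd_w (x := v) (p := [:: x; y]).
have := odd_w (x := v) (p := y :: p).
case/lastP: p => [|p x'] in pP p_last Up vp *.
  by move: xy; rewrite /= in p_last; rewrite p_last arc_irrefl.
rewrite last_rcons in p_last; rewrite {x'}p_last in pP Up vp *.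
have := odd_w (x := y) (p := rcons p x) Up.
rewrite [uniq (v :: y :: _)]cons_uniq vp Up /= !inE !negb_or !rcons_path !last_rcons.
rewrite -rcons_path pP xy avx axv avy ayv (eq_sym v) xv (eq_sym v) yv arc_neq //=.
rewrite -!cats1 !walk_parity_cat /= !last_cat /= !addbF.
move=> /(_ isT) + /(_ isT isT) + /(_ isT isT).
rewrite (odd_digon vx) (odd_digon vy).
move: (walk_parity _ _ _) (w (last y p) x) (w x y) (w x v) (w y v).
by do 5!case.
Qed.

(** * Three even configurations *)

(** The cycles chosen in each of the three proofs below are odd in number and
    cover each of their arcs exactly twice; the exhaustion over the weights
    only checks this. *)
Lemma no_K23 a b c d x : uniq [:: a; b; c; d; x] -> digon a b -> digon a d ->
  digon c b -> digon c d -> digon x b -> digon x d -> False.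
Proof.
move=> Us /andP[ab ba] /andP[ad da] /andP[cb bc] /andP[cd dc] /andP[xb bx] /andP[xd dx].
have odd_s i l := odd_on_nth_cycle (x0 := a) (i := i) (l := l) odd_w Us.
have := odd_s 0 [:: 1] isT isT.
have := odd_s 0 [:: 3] isT isT.
have := odd_s 0 [:: 1; 2; 3] isT isT.
have := odd_s 0 [:: 3; 4; 1] isT isT.
have := odd_s 1 [:: 2; 3; 4] isT isT.
rewrite /= ab ba ad da bc cd dx xb !addbF.
move=> /(_ isT) + /(_ isT) + /(_ isT) + /(_ isT) + /(_ isT).
move: (w a b) (w b a) (w a d) (w d a) (w b c) (w c d) (w d x) (w x b).
by do 8!case=> //=.
Qed.

(** An apex [x] joined in alternating directions to the four vertices of a
    C_4^*. *)
Lemma no_C4star_pyramid a b c d x : uniq [:: a; b; c; d; x] ->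
  digon a b -> digon b c -> digon c d -> digon d a ->
  arc x a -> arc b x -> arc x c -> arc d x -> False.
Proof.
move=> Us /andP[ab ba] /andP[bc cb] /andP[cd dc] /andP[da ad] xa bx xc dx.
have odd_s i l := odd_on_nth_cycle (x0 := a) (i := i) (l := l) odd_w Us.
have := odd_s 0 [:: 1] isT isT.
have := odd_s 0 [:: 1; 4] isT isT.
have := odd_s 0 [:: 3; 4; 2; 1] isT isT.
have := odd_s 1 [:: 4; 2] isT isT.
have := odd_s 0 [:: 3; 4] isT isT.
rewrite /= ab ba bx xa ad dx xc cb !addbF.
move=> /(_ isT) + /(_ isT) + /(_ isT) + /(_ isT) + /(_ isT).
move: (w a b) (w b a) (w b x) (w x a) (w a d) (w d x) (w x c) (w c b).
by do 8!case=> //=.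
Qed.

(** The arcs assumed here are among those of the circular digraph on
    a, b, c, a', b', c' in this cyclic order, in which each vertex dominates
    the next three. *)
Lemma no_circular6 a b c a' b' c' : uniq [:: a; a'; b; b'; c; c'] ->
  digon a a' -> digon b b' ->
  arc a b -> arc a c -> arc b c -> arc c a' -> arc c c' ->
  arc a' b' -> arc b' a -> arc c' a -> False.
Proof.
move=> Us /andP[aa' a'a] /andP[bb' b'b] ab ac bc ca' cc' a'b' b'a c'a.
have odd_s i l := odd_on_nth_cycle (x0 := a) (i := i) (l := l) odd_w Us.
have := odd_s 2 [:: 3] isT isT.
have := odd_s 0 [:: 2; 3] isT isT.
have := odd_s 0 [:: 4; 1] isT isT.
have := odd_s 0 [:: 2; 4; 1] isT isT.
have := odd_s 0 [:: 4; 5] isT isT.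
have := odd_s 0 [:: 1; 3] isT isT.
have := odd_s 0 [:: 1; 3; 2; 4; 5] isT isT.
rewrite /= aa' a'a bb' b'b ab ac bc ca' cc' a'b' b'a c'a !addbF.
move=> /(_ isT) + /(_ isT) + /(_ isT) + /(_ isT) + /(_ isT) + /(_ isT) + /(_ isT).
move: (w a a') (w a' a) (w b b') (w b' b) (w a b) (w a c) (w b c) (w c a') (w c c').
move: (w a' b') (w b' a) (w c' a).
by do 12!case=> //=.
Qed.

Section DegreeBound.
Hypothesis deg_ge : forall v : D, #|D| <= degree v.

(** * Digons form disjoint complete bipartite graphs *)

Lemma digon_nbrsD1_sub u v : digon u v -> digon_nbrs u :\ v \subset non_nbrs v.
Proof.
move=> uv; apply/subsetP => z; rewrite !inE => /andP[-> uz] /=.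
by rewrite !(digon_nbrs_no_arc (v := u)).
Qed.

(** By the degree bound, the inclusion [digon_nbrsD1_sub] makes the number of
    digon-neighbours weakly increase along every digon; since a digon can be
    followed in both directions, it is constant and the inclusion is an
    equality. *)
Lemma digon_nbrsE u v : digon u v -> digon_nbrs u = v |: non_nbrs v.
Proof.
have le_card x y : digon x y -> #|digon_nbrs x| <= #|digon_nbrs y|.
  move=> xy; rewrite (cardsD1 y) inE xy /=.
  apply: leq_ltn_trans (ltn_non_nbrs_digon_nbrs (deg_ge y)).
  exact/subset_leq_card/digon_nbrsD1_sub.
move=> uv; rewrite -(setD1K (a := v) (A := digon_nbrs u)) ?inE //; congr (_ |: _).
apply/eqP; rewrite eqEcard digon_nbrsD1_sub //=.
rewrite -ltnS; apply: leq_trans (ltn_non_nbrs_digon_nbrs (deg_ge v)) _.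
have := cardsD1 v (digon_nbrs u); rewrite inE uv add1n => <-.
by rewrite le_card // digonC.
Qed.

Lemma digon_or_non_nbr u v z : digon u v -> digon u z = (z == v) || (z \in non_nbrs v).
Proof. by move=> uv; rewrite -in_setU1 -(digon_nbrsE uv) inE. Qed.

Lemma digon_exists v : exists u, digon v u.
Proof.
have /(leq_ltn_trans (leq0n _))/card_gt0P[u] := ltn_non_nbrs_digon_nbrs (deg_ge v).
by rewrite inE; exists u.
Qed.

(** * A vertex in two digons *)

Lemma isomorphic_C4star a b d :
  digon a b -> digon a d -> b != d -> isomorphic D C4star.
Proof.
move=> ab ad neq_bd.
have ba : digon b a by rewrite digonC.
have da : digon d a by rewrite digonC.
have bNd : d \in non_nbrs b.
  by have := digon_or_non_nbr d ab; rewrite ad eq_sym (negPf neq_bd).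
(* The degree bound at b, which has the non-neighbour d, yields a second
   digon-neighbour c of b; it is also one of d because Z(b) and Z(d) are both
   equal to {a} + N(a). *)
have [c] : exists c, c \in digon_nbrs b :\ a.
  apply/card_gt0P; have := ltn_non_nbrs_digon_nbrs (deg_ge b).
  rewrite (cardsD1 a (digon_nbrs b)) inE ba ltnS; apply: leq_trans.
  by apply/card_gt0P; exists d.
rewrite !inE => /andP[neq_ca bc].
have cb : digon c b by rewrite digonC.
have Zd z : digon d z = digon b z.
  by rewrite (digon_or_non_nbr _ da) -(digon_or_non_nbr _ ba).
have Zc z : digon c z = digon a z.
  by rewrite (digon_or_non_nbr _ cb) -(digon_or_non_nbr _ ab).
have dc : digon d c by rewrite Zd.
have cd : digon c d by rewrite Zc.
have Us : uniq [:: a; b; c; d].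
  rewrite /= !inE !negb_or (eq_sym a c) neq_ca neq_bd.
  by rewrite (digon_neq ab) (digon_neq ad) (digon_neq bc) (digon_neq cd).
have s_all x : x \in [:: a; b; c; d].
  apply: contraT => xs; exfalso.
  have Uxs : uniq [:: a; b; c; d; x].
    by rewrite -[_ :: _]/(rcons [:: a; b; c; d] x) rcons_uniq xs.
  have Uxs' : uniq [:: b; c; d; a; x].
    by rewrite (uniq_catCA [:: b; c; d] [:: a] [:: x]).
  have [ax | ax] := boolP (digon a x).
    by apply: (@no_K23 b c d a x); rewrite // 1?(digonC x) ?Zc.
  have [bx | bx] := boolP (digon b x).
    by apply: (@no_K23 a b c d x); rewrite // 1?(digonC x) ?Zd.
  have x_arc u t : u \in [:: a; b; c; d] -> digon t u -> ~~ digon t x ->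
      ~~ digon u x -> arc u x = ~~ arc x u.
    move=> us tu tx ux; have xu : x != u by apply: contraNneq xs => ->.
    move: tx ux; rewrite (digon_or_non_nbr _ tu) inE (negPf xu) /digon /=.
    by case: arc; case: arc.
  have ax_xa : arc a x = ~~ arc x a by apply: (x_arc a b); rewrite ?mem_head.
  have bx_xb : arc b x = ~~ arc x b by apply: (x_arc b a); rewrite ?inE ?eqxx ?orbT.
  have cx_xc : arc c x = ~~ arc x c by apply: (x_arc c b); rewrite ?inE ?eqxx ?orbT ?Zc.
  have dx_xd : arc d x = ~~ arc x d by apply: (x_arc d a); rewrite ?inE ?eqxx ?orbT ?Zd.
  have alt u v : digon u v -> arc u x = ~~ arc x u -> arc v x = ~~ arc x v ->
      arc x v = ~~ arc x u.
    move=> uv ux_xu vx_xv.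
    have := @digon_in_nbrs _ _ x uv; have := @digon_out_nbrs _ _ x uv.
    by rewrite ux_xu vx_xv; case: (arc x u); case: (arc x v).
  have := alt _ _ ab ax_xa bx_xb; have := alt _ _ bc bx_xb cx_xc.
  have := alt _ _ cd cx_xc dx_xd.
  have [xa | xa] := boolP (arc x a) => xd xc xb.
    by apply: (@no_C4star_pyramid a b c d x); rewrite // ?bx_xb ?dx_xd ?xd ?xc ?xb ?xa.
  by apply: (@no_C4star_pyramid b c d a x); rewrite // ?cx_xc ?ax_xa ?xd ?xc ?xb ?xa.
apply: (@isomorphic_of_enum _ _ _ a [:: a; b; c; d]) => //.
have /andP[aab aba] := ab; have /andP[aad ada] := ad.
have /andP[abc acb] := bc; have /andP[acd adc] := cd.
have : c \in non_nbrs a by have := digon_or_non_nbr c ba; rewrite bc (negPf neq_ca).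
move: bNd; rewrite !inE.
move=> /and3P[_ /negPf nbd /negPf ndb] /and3P[_ /negPf nac /negPf nca].
case=> [[|[|[|[|i]]]] lti] // [[|[|[|[|j]]]] ltj] //=;
  by rewrite ?arc_irrefl ?(aab, aba, aad, ada, abc, acb, acd, adc, nbd, ndb, nac, nca).
Qed.

(** * Digons forming a perfect matching *)

Section PerfectMatching.
Hypothesis digon_inj : forall u v v', digon u v -> digon u v' -> v = v'.

(** A non-neighbour of [v] would be a second digon-neighbour of the partner of
    [v]. *)
Lemma semicomplete u v : u != v -> @arc D u v || arc v u.
Proof.
move=> neq_uv; have [t vt] := digon_exists v; have tv : digon t v by rewrite digonC.
have := digon_or_non_nbr u tv; rewrite inE (negPf neq_uv) /=.
have [|_] := boolP (digon t u); last by case: arc; case: arc.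
by move=> tu; move: neq_uv; rewrite (digon_inj tu tv) eqxx.
Qed.

Lemma arc_single x x' v : digon x x' -> v != x -> v != x' -> arc x v = ~~ arc v x.
Proof.
move=> xx' vx vx'; have := semicomplete vx; have := @digon_inj x x' v xx'.
rewrite /digon; case: (arc v x); case: (arc x v) => //= /(_ isT) eq_x'v.
by rewrite eq_x'v eqxx in vx'.
Qed.

Lemma arc_alternates x x' v : digon x x' -> v != x -> v != x' -> arc v x' = ~~ arc v x.
Proof.
move=> xx' vx vx'.
have x'x : digon x' x by rewrite digonC.
have := @digon_in_nbrs _ _ v xx'; have := @digon_out_nbrs _ _ v xx'.
rewrite (arc_single xx') // (arc_single x'x) //.
by case: (arc v x); case: (arc v x').
Qed.

Lemma digon_pair_arcs v v' x x' : digon v v' -> digon x x' ->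
    x \notin [:: v; v'] -> arc v x ->
  [/\ arc x v', arc v' x', arc x' v &
    [/\ arc x v = false, arc v' x = false, arc x' v' = false & arc v x' = false]].
Proof.
rewrite !inE negb_or => vv' xx' /andP[xv xv'] vx.
have v'v : digon v' v by rewrite digonC.
have x'x : digon x' x by rewrite digonC.
have x'v : x' != v.
  by apply: contraNneq xv' => x'v; rewrite x'v in x'x; rewrite (digon_inj x'x vv').
have x'v' : x' != v'.
  by apply: contraNneq xv => x'v'; rewrite x'v' in x'x; rewrite (digon_inj x'x v'v).
have [vNx vNx'] : v != x /\ v != x' by rewrite !(eq_sym v).
have [v'Nx v'Nx'] : v' != x /\ v' != x' by rewrite !(eq_sym v').
have xv0 : arc x v = false by rewrite (arc_single xx') ?vx.
have xv'1 : arc x v' by rewrite (arc_alternates vv') ?xv0.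
have v'x0 : arc v' x = false by rewrite (arc_single v'v) ?xv'1.
have vx'0 : arc v x' = false by rewrite (arc_alternates xx') ?vx.
have v'x'1 : arc v' x' by rewrite (arc_alternates xx') ?v'x0.
have x'v1 : arc x' v by rewrite (arc_single x'x) ?vx'0.
by have x'v'0 : arc x' v' = false by rewrite (arc_single x'x) ?v'x'1.
Qed.

(** The orientation [arc v x] is obtained by exchanging [x] and [x'], because
    the arcs between [v] and these two vertices have opposite directions. *)
Lemma digon_avoiding s v : (forall x y, digon x y -> x \in s -> y \in s) -> v \in s ->
  ~~ [forall x, x \in s] ->
  exists x x', [/\ digon x x', arc v x, x \notin s & x' \notin s].
Proof.
move=> s_closed vs /forallPn[x xs]; have [x' xx'] := digon_exists x.
have x'x : digon x' x by rewrite digonC.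
have x's : x' \notin s by apply: contra xs; apply: s_closed.
have vx : v != x by apply: contraNneq xs => <-.
have vx' : v != x' by apply: contraNneq x's => <-.
have [av|av] := boolP (arc v x); first by exists x, x'.
by exists x', x; rewrite (arc_alternates xx').
Qed.

Lemma isomorphic_W4 : isomorphic D W4.
Proof.
have [gt2D _] := conn.
have [v _] : exists v, v \in D by apply/card_gt0P; apply: leq_trans gt2D.
have [v' vv'] := digon_exists v; have v'v : digon v' v by rewrite digonC.
have closed2 x y : digon x y -> x \in [:: v; v'] -> y \in [:: v; v'].
  rewrite !inE => xy /orP[] /eqP eqx; rewrite eqx in xy.
    by rewrite (digon_inj xy vv') eqxx orbT.
  by rewrite (digon_inj xy v'v) eqxx.
have vs2 : v \in [:: v; v'] by rewrite mem_head.
have not_all2 : ~~ [forall x, x \in [:: v; v']].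
  apply: contraL gt2D => /forallP all2; rewrite -leqNgt.
  by apply: leq_trans (card_size [:: v; v']); apply/subset_leq_card/subsetP.
have [x [x' [xx' vx xs x's]]] := digon_avoiding closed2 vs2 not_all2.
have x'x : digon x' x by rewrite digonC.
have [xv' v'x' x'v [xv v'x x'v'N vx'N]] := digon_pair_arcs vv' xx' xs vx.
have Us : uniq [:: v; v'; x; x'].
  rewrite -[_ :: _]/([:: v; v'] ++ [:: x; x']) cat_uniq /= !inE orbF !negb_or.
  by move: xs x's; rewrite !inE !negb_or (digon_neq vv') (digon_neq xx') => -> ->.
have perm_s : perm_eq [:: v; x; v'; x'] [:: v; v'; x; x'].
  by rewrite perm_cons (perm_catCA [:: x] [:: v'] [:: x']).
have [/forallP all4 | not_all4] := boolP [forall z, z \in [:: v; v'; x; x']].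
  apply: (@isomorphic_of_enum _ _ _ v [:: v; x; v'; x']) => //.
  - by rewrite (perm_uniq perm_s).
  - by move=> z; rewrite (perm_mem perm_s).
  have /andP[avv' av'v] := vv'; have /andP[axx' ax'x] := xx'.
  case=> [[|[|[|[|i]]]] lti] // [[|[|[|[|j]]]] ltj] //=;
    by rewrite ?arc_irrefl ?(avv', av'v, axx', ax'x, vx, xv', v'x', x'v,
                             xv, v'x, x'v'N, vx'N).
have closed4 z y : digon z y -> z \in [:: v; v'; x; x'] -> y \in [:: v; v'; x; x'].
  rewrite !inE => zy /or4P[] /eqP eqz; rewrite eqz in zy.
  - by rewrite (digon_inj zy vv') eqxx ?orbT.
  - by rewrite (digon_inj zy v'v) eqxx ?orbT.
  - by rewrite (digon_inj zy xx') eqxx ?orbT.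
  - by rewrite (digon_inj zy x'x) eqxx ?orbT.
have [y [y' [yy' vy ys y's]]] := digon_avoiding closed4 (mem_head v _) not_all4.
have ys2 : y \notin [:: v; v'].
  by apply: contra ys; rewrite !inE => /orP[] ->; rewrite ?orbT.
have [yv' v'y' y'v _] := digon_pair_arcs vv' yy' ys2 vy.
have Uxy : uniq [:: v; v'; x; x'; y; y'].
  rewrite -[_ :: _]/([:: v; v'; x; x'] ++ [:: y; y']) cat_uniq Us [has _ _]/= orbF.
  by rewrite negb_or ys y's /= inE (digon_neq yy').
have Uyx : uniq [:: v; v'; y; y'; x; x'].
  have /perm_uniq <- // : perm_eq [:: v; v'; x; x'; y; y'] [:: v; v'; y; y'; x; x'].
  by rewrite !perm_cons (perm_catC [:: x; x'] [:: y; y']).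
have neq_xy : x != y by apply: contraNneq ys => <-; rewrite !inE eqxx ?orbT.
have /andP[axx' _] := xx'; have /andP[ayy' _] := yy'.
(* Exchanging the two digons, the arc between x and y may be taken to leave
   the one named first, which puts v, x, y, v', x', y' in circular order. *)
exfalso; have /orP[xy | yx] := semicomplete neq_xy.
  exact: (no_circular6 Uxy).
exact: (no_circular6 Uyx).
Qed.

End PerfectMatching.
End DegreeBound.
End Noneven.
End Parity.

Theorem theorem5p2 (D : digraph) (n : nat) (hn : #|D| = n)
    (h2 : strongly_2connected D) (hne : noneven D)
    (hdeg : forall v : D, n <= degree v) :
  isomorphic D W4 \/ isomorphic D C4star.
Proof.
have [w odd_w] := noneven_odd_on_cycles hne; rewrite -hn in hdeg.
have [/existsP[a /existsP[b /existsP[d /and3P[ab ad neq_bd]]]] | matching] :=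
  boolP [exists a : D, exists b, exists d, [&& digon a b, digon a d & b != d]].
  by right; apply: (isomorphic_C4star odd_w h2 hdeg ab ad neq_bd).
left; apply: (isomorphic_W4 odd_w) => // u v v' uv uv'.
apply: contraNeq matching => neq_vv'; apply/existsP; exists u.
by apply/existsP; exists v; apply/existsP; exists v'; rewrite uv uv'.
Qed.
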